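(* Consider any instance of online submodular order welfare maximization (OSOW) with configurations, as defined in the context. Let $\mathrm{ALG}$ denote the set of configurations chosen by the Greedy algorithm and let $\mathrm{OPT}=\max\{\sum_{i\in I} f_i(S)\,:\, S\subseteq N,\ |S\cap N_t|\le 1\ \forall t\in T\}$ be the optimal offline value. Then $\sum_{i\in I} f_i(\mathrm{ALG})\ \ge\ \tfrac12\,\mathrm{OPT}$, i.e., Greedy is $0.5$-competitive for OSOW with configurations.
   Context: An instance consists of a finite set $I$ of resources and arrivals $T=\{1,2,\dots,T\}$ arriving one at a time in this order. For each arrival $t$ there is a finite set $N_t$ of feasible configurations, each a pair $(R,t)$ with $R\subseteq I$; let $N=\bigcup_{t\in T}N_t$ and $N_i=\{(R,t)\in N: i\in R\}$. A set $S\subseteq N$ is a feasible allocation if $|S\cap N_t|\le 1$ for all $t$. Each resource $i$ has an objective function $f_i:2^N\to\mathbb{R}_{\ge 0}$ that is monotone, has $f_i(\emptyset)=0$, satisfies $f_i(S)=f_i(S\cap N_i)$ for all $S\subseteq N$, and is linear over each $N_t$: $f_i(N_t\cup S)=f_i(S)+\sum_{e\in N_t} f_i(e\mid S)$ for all $S\subseteq N\setminus N_t$, where $f(X\mid S)=f(X\cup S)-f(S)$ and $f(e\mid S)=f(\{e\}\mid S)$. Submodular order: for a total order $\pi$ on $N$, a set $C$ succeeds a set $A$ if every element of $C$ comes after every element of $A$ in $\pi$; sets $B\subseteq A$ are $\pi$-nested if $A\setminus B$ succeeds $B$; $\pi$ is a submodular order for $f$ if $f(C\mid A)\le f(C\mid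 B)$ for all $\pi$-nested $B\subseteq A\subseteq N$ and all $C\subseteq N$ that succeed $A$. A total order on $N$ is arrival-consistent if $N_{t+1}$ succeeds $N_t$ for every $t\le T-1$. In OSOW each $f_i$ is required to have every arrival-consistent total order on $N$ as a submodular order. Online, when arrival $t$ appears the algorithm learns $N_t$ and must irrevocably choose at most one configuration in $N_t$. The Greedy algorithm, with $\mathrm{ALG}(t)$ the set of configurations it chose before arrival $t$, chooses $\mathrm{ALG}_t\in\arg\max_{e\in N_t}\sum_{i\in I} f_i(e\mid \mathrm{ALG}(t))$. *)

(* Defs.v *)
(* Real values are taken in an arbitrary [realFieldType]. *)
From mathcomp Require Import all_boot all_order all_algebra.

Set Implicit Arguments.
Unset Strict Implicit.
Unset Printing Implicit Defensive.

Import Order.TTheory GRing.Theory Num.Theory.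
Local Open Scope ring_scope.

(* Arrivals are 0-indexed. *)
Definition config (I : finType) (T : nat) : finType := ({set I} * 'I_T)%type.

Section Configurations.
Variables (I : finType) (T : nat).

(* [menu t] lists the resource sets [X] such that [(X, t)] is feasible for
   arrival [t]; it may be empty. *)
Variable menu : 'I_T -> {set {set I}}.

Definition configs_at (t : 'I_T) : {set config I T} :=
  [set ((X, t) : config I T) | X in menu t].

Definition configs : {set config I T} := \bigcup_(t < T) configs_at t.

Definition configs_using (i : I) : {set config I T} :=
  [set e in configs | i \in e.1].

Definition feasible (S : {set config I T}) : bool :=
  (S \subset configs) && [forall t, #|S :&: configs_at t| <= 1]%N.

Lemma feasible_set0 : feasible set0.
Proof. by rewrite /feasible sub0set; apply/forallP => t; rewrite set0I cards0. Qed.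

End Configurations.

Section Orders.
Variables (I : finType) (T : nat) (menu : 'I_T -> {set {set I}}).
Implicit Types (pi : rel (config I T)) (A B C : {set config I T}).

Definition total_order_on (N : {set config I T}) pi : Prop :=
  [/\ {in N, reflexive pi}, {in N &, antisymmetric pi},
      {in N & &, transitive pi} & {in N &, total pi}].

Definition succeeds pi C A : Prop :=
  forall c a, c \in C -> a \in A -> pi a c && (a != c).

Definition nested pi B A : Prop := B \subset A /\ succeeds pi (A :\: B) B.

Definition arrival_consistent pi : Prop :=
  forall s t : 'I_T, t = s.+1 :> nat ->
    succeeds pi (configs_at menu t) (configs_at menu s).

End Orders.

Section Objectives.
Variables (R : realFieldType) (I : finType) (T : nat).
Variable menu : 'I_T -> {set {set I}}.
Implicit Types (g : {set config I T} -> R) (f : I -> {set config I T} -> R).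

Definition marginal g (X S : {set config I T}) : R := g (X :|: S) - g S.

Definition submodular_order g (pi : rel (config I T)) : Prop :=
  forall A B C : {set config I T},
    A \subset configs menu -> C \subset configs menu ->
    nested pi B A -> succeeds pi C A ->
    marginal g C A <= marginal g C B.

(* Objectives have domain the subsets of [configs menu], so no condition below
   constrains their values on other sets. *)
Record osow f : Prop := Osow {
  osow_ge0 : forall i (S : {set config I T}), S \subset configs menu -> 0 <= f i S;
  osow_monotone : forall i (A B : {set config I T}),
    A \subset B -> B \subset configs menu -> f i A <= f i B;
  osow_set0 : forall i, f i set0 = 0;
  osow_local : forall i (S : {set config I T}), S \subset configs menu ->
    f i S = f i (S :&: configs_using menu i);
  osow_linear : forall i t (S : {set config I T}),
    S \subset configs menu :\: configs_at menu t ->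
    f i (configs_at menu t :|: S) =
    f i S + \sum_(e in configs_at menu t) marginal (f i) [set e] S;
  osow_submodular_order : forall i (pi : rel (config I T)),
    total_order_on (configs menu) pi -> arrival_consistent menu pi ->
    submodular_order (f i) pi
}.

Definition welfare f (S : {set config I T}) : R := \sum_(i : I) f i S.

(* A genuine maximum, the set of candidates being nonempty by [feasible_set0]. *)
Definition OPT f : R :=
  welfare f [arg max_(S > set0 | feasible menu S) welfare f S]%O.

(* A run records the choice made at each arrival, [None] meaning no choice. *)
Implicit Type alg : 'I_T -> option (config I T).

Definition chosen_before alg (t : 'I_T) : {set config I T} :=
  [set e | [exists s : 'I_T, (s < t)%N && (alg s == Some e)]].

Definition chosen alg : {set config I T} :=
  [set e | [exists s : 'I_T, alg s == Some e]].

(* Ties are broken arbitrarily; no choice is made only if none is available. *)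
Definition greedy_run f alg : Prop :=
  forall t : 'I_T,
    match alg t with
    | Some e =>
        e \in configs_at menu t /\
        forall e', e' \in configs_at menu t ->
          \sum_(i : I) marginal (f i) [set e'] (chosen_before alg t) <=
          \sum_(i : I) marginal (f i) [set e] (chosen_before alg t)
    | None => configs_at menu t = set0
    end.

End Objectives.

(* Main.v *)
(* Order the configurations by arrival and, within an arrival, put the one
   chosen by Greedy first. Adding the optimal configurations to ALG from the
   last arrival to the first, the submodular order bounds the gain of the one
   for arrival [t] by its marginal value over the choices made before [t],
   hence, by the greedy rule, by the marginal value of Greedy's own choice.
   These values sum up to the welfare of ALG, so
   OPT <= welfare (ALG :|: optimal set) <= 2 * welfare ALG. *)
Require Import Defs.
From mathcomp Require Import all_boot all_order all_algebra.
From mathcomp Require Import zify lra.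

Set Implicit Arguments.
Unset Strict Implicit.
Unset Printing Implicit Defensive.

Import Order.TTheory GRing.Theory Num.Theory.
Local Open Scope ring_scope.

Section Arrivals.
Variables (I : finType) (T : nat).
Implicit Types (S : {set config I T}) (n : nat) (e : config I T).

(** The cut [n] is a natural number rather than an ordinal so that the bound [T] is allowed: there
    [before S T] is all of [S] and [from S T] is empty. *)
Definition before S n : {set config I T} := [set e in S | (e.2 < n)%N].
Definition from S n : {set config I T} := [set e in S | (n <= e.2)%N].
Definition at_arrival S n : {set config I T} := [set e in S | e.2 == n :> nat].

Lemma before_sub S n : before S n \subset S.
Proof. by apply/subsetP => e; rewrite inE => /andP[]. Qed.

Lemma before0 S : before S 0 = set0.
Proof. by apply/setP => e; rewrite !inE ltn0 andbF. Qed.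

Lemma before_all S : before S T = S.
Proof. by apply/setP => e; rewrite !inE ltn_ord andbT. Qed.

Lemma from_sub S n : from S n \subset S.
Proof. by apply/subsetP => e; rewrite inE => /andP[]. Qed.

Lemma from0 S : from S 0 = S.
Proof. by apply/setP => e; rewrite !inE andbT. Qed.

Lemma from_all S : from S T = set0.
Proof. by apply/setP => e; rewrite !inE leqNgt ltn_ord andbF. Qed.

Lemma at_arrival_sub S n : at_arrival S n \subset S.
Proof. by apply/subsetP => e; rewrite inE => /andP[]. Qed.

Lemma beforeS S n : before S n.+1 = at_arrival S n :|: before S n.
Proof. by apply/setP => e; rewrite !inE ltnS leq_eqVlt andb_orr. Qed.

(* The key is lexicographic in arrival, membership in [S] (members first) and
   rank. *)
Definition key S e : nat :=
  ((e.2 * 2 + (e \notin S)) * #|config I T| + enum_rank e)%N.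

Definition order_first S : rel (config I T) := fun x y => (key S x <= key S y)%N.

Lemma key_inj S : injective (key S).
Proof.
(* Modulo the number of configurations only the rank is left. *)
move=> x y /(congr1 (modn^~ #|config I T|)).
rewrite /key !modnMDl !modn_small ?ltn_ord // => /val_inj.
exact: enum_rank_inj.
Qed.

(** Ranks stay below the factor [#|config I T|], so they cannot make up for a gap in the leading
    part. *)
Lemma key_lt S (x y : config I T) :
  (x.2 * 2 + (x \notin S) < y.2 * 2 + (y \notin S))%N -> (key S x < key S y)%N.
Proof.
move=> lt_xy; rewrite /key.
apply: (@leq_trans ((x.2 * 2 + (x \notin S)).+1 * #|config I T|)).
  by rewrite mulSnr ltn_add2l ltn_ord.
by apply: leq_trans (leq_addr _ _); rewrite leq_mul2r lt_xy orbT.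
Qed.

Lemma order_first_lt S (x y : config I T) :
  (x.2 * 2 + (x \notin S) < y.2 * 2 + (y \notin S))%N ->
  order_first S x y && (x != y).
Proof.
move=> /key_lt lt_xy; rewrite /order_first ltnW //=.
by apply: contraTneq lt_xy => ->; rewrite ltnn.
Qed.

Lemma order_first_arrival S (x y : config I T) :
  (x.2 < y.2)%N -> order_first S x y && (x != y).
Proof. by move=> lt_xy; apply: order_first_lt; lia. Qed.

Lemma order_first_total S (N : {set config I T}) :
  total_order_on N (order_first S).
Proof.
split.
- by move=> x _; rewrite /order_first.
- by move=> x y _ _ /anti_leq /key_inj.
- by move=> y x z _ _ _; apply: leq_trans.
- by move=> x y _ _; apply: leq_total.
Qed.

End Arrivals.

Section Greedy.
Variables (R : realFieldType) (I : finType) (T : nat).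
Variable menu : 'I_T -> {set {set I}}.
Implicit Types (g : {set config I T} -> R) (f : I -> {set config I T} -> R).
Implicit Types (A O S : {set config I T}) (alg : 'I_T -> option (config I T)).

Lemma configs_at_arrival t (e : config I T) :
  e \in configs_at menu t -> e.2 = t.
Proof. by case/imsetP => X _ ->. Qed.

Lemma configs_atP (e : config I T) :
  (e \in configs menu) = (e \in configs_at menu e.2).
Proof.
apply/bigcupP/idP => [[t _ et]|]; last by exists e.2.
by rewrite (configs_at_arrival et).
Qed.

Lemma order_first_consistent S : arrival_consistent menu (order_first S).
Proof.
move=> s t ts c a /configs_at_arrival ct /configs_at_arrival a_s.
by apply: order_first_arrival; rewrite ct a_s ts.
Qed.

(** With [C] for what [A] and [O] contain after arrival [n], the left side is the marginal value of
    [D] over [C] and [before A n.+1] together. Two uses of the submodular order remove first [C],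
    then the part of [A] at arrival [n], from the conditioning set. *)
Lemma exchange_step g A O n :
  (forall X Y : {set config I T}, X \subset Y -> Y \subset configs menu -> g X <= g Y) ->
  submodular_order menu g (order_first A) ->
  A \subset configs menu -> O \subset configs menu ->
  g (A :|: from O n) - g (A :|: from O n.+1) <=
  marginal g (at_arrival O n) (before A n).
Proof.
move=> mono so AN ON; set D := at_arrival O n :\: A.
have DN : D \subset configs menu.
  exact: subset_trans (subsetDl _ _) (subset_trans (at_arrival_sub _ _) ON).
have BN m : before A m \subset configs menu.
  exact: subset_trans (before_sub _ _) AN.
have CN : from (A :|: O) n.+1 \subset configs menu.
  by rewrite (subset_trans (from_sub _ _)) // subUset AN.
have DBN : D :|: before A n.+1 \subset configs menu by rewrite subUset DN BN.
(* This is where members of [A] must come first: elements of [D] share arrival [n] with some of them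
   but lie outside [A]. *)
have nestD : nested (order_first A) (before A n.+1) (D :|: before A n.+1).
  split=> [|c a]; first exact: subsetUr.
  rewrite !inE => cin ain; apply: order_first_lt.
  by move: cin ain; case: (c \in A); case: (a \in A) => //=; lia.
have nestA : nested (order_first A) (before A n) (before A n.+1).
  split=> [|c a]; first by rewrite beforeS subsetUr.
  rewrite !inE => cin ain; apply: order_first_arrival.
  by move: cin ain; case: (c \in A); case: (a \in A) => //=; lia.
have succC : succeeds (order_first A) (from (A :|: O) n.+1) (D :|: before A n.+1).
  move=> c a; rewrite !inE => cin ain; apply: order_first_arrival.
  by move: cin ain; case: (a \in A); case: (a \in O) => //=; lia.
have succD : succeeds (order_first A) D (before A n.+1).
  move=> c a; rewrite !inE => cin ain; apply: order_first_lt.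
  by move: cin ain; case: (c \in A); case: (a \in A) => //=; lia.
(* Rearranged, this bounds the marginal value of [D] in the presence of [C] by that in its
   absence. *)
have := so _ _ _ DBN CN nestD succC.
have := so _ _ _ (BN n.+1) DN nestA succD.
(* Monotonicity puts back the elements of [O] at arrival [n] that [D] omits because they lie in
   [A]. *)
have : g (D :|: before A n) <= g (at_arrival O n :|: before A n).
  apply: mono; first by rewrite setSU ?subsetDl.
  by rewrite subUset BN (subset_trans (at_arrival_sub _ _) ON).
have -> : A :|: from O n = from (A :|: O) n.+1 :|: (D :|: before A n.+1).
  by apply/setP => e; rewrite !inE; case: (e \in A); case: (e \in O) => //=; lia.
have -> : A :|: from O n.+1 = from (A :|: O) n.+1 :|: before A n.+1.
  by apply/setP => e; rewrite !inE; case: (e \in A); case: (e \in O) => //=; lia.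
rewrite /marginal; lra.
Qed.

Lemma sum_marginal f X S :
  \sum_i marginal (f i) X S = welfare f (X :|: S) - welfare f S.
Proof. by rewrite /marginal sumrB. Qed.

Variables (f : I -> {set config I T} -> R) (hf : osow menu f).

Lemma welfare_mono A S :
  A \subset S -> S \subset configs menu -> welfare f A <= welfare f S.
Proof. by move=> AS SN; apply: ler_sum => i _; apply: (osow_monotone hf). Qed.

Lemma feasible_at_arrival O (t : 'I_T) : feasible menu O ->
  at_arrival O t = set0 \/
  exists2 o, o \in configs_at menu t & at_arrival O t = [set o].
Proof.
case/andP => /subsetP ON /forallP/(_ t).
have -> : O :&: configs_at menu t = at_arrival O t.
  apply/setP => e; rewrite !inE; case: (boolP (e \in O)) => //= eO.
  have := ON e eO; rewrite configs_atP => eN.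
  apply/idP/eqP => [/configs_at_arrival ->//|/val_inj et].
  by rewrite -et.
rewrite leq_eqVlt ltnS leqn0 cards_eq0 => /orP[/cards1P[o o_def]|/eqP]; last by left.
right; exists o => //.
have : o \in at_arrival O t by rewrite o_def set11.
by rewrite inE => /andP[/ON]; rewrite configs_atP => oN /eqP/val_inj <-.
Qed.

Variables (alg : 'I_T -> option (config I T)) (halg : greedy_run menu f alg).

Lemma alg_configs t e : alg t = Some e -> e \in configs_at menu t.
Proof. by move=> et; have := halg t; rewrite et => -[]. Qed.

(** A greedy choice is feasible for the arrival at which it is made, so the existential witness can
    only be [e.2]. *)
Lemma chosenP e : reflect (alg e.2 = Some e) (e \in chosen alg).
Proof.
rewrite inE; apply: (iffP existsP) => [[s /eqP es]|es]; last by exists e.2; apply/eqP.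
by rewrite (configs_at_arrival (alg_configs es)).
Qed.

Lemma chosen_configs : chosen alg \subset configs menu.
Proof. by apply/subsetP => e /chosenP/alg_configs; rewrite configs_atP. Qed.

Lemma chosen_beforeE t : chosen_before alg t = before (chosen alg) t.
Proof.
apply/setP => e; rewrite [RHS]inE inE.
apply/existsP/andP => [[s /andP[st /eqP es]]|[/chosenP es et]].
  have e2 := configs_at_arrival (alg_configs es).
  by rewrite e2; split=> //; apply/chosenP; rewrite e2.
by exists e.2; rewrite et es eqxx.
Qed.

Lemma greedy_step (t : 'I_T) O : feasible menu O ->
  welfare f (at_arrival O t :|: before (chosen alg) t) <=
  welfare f (before (chosen alg) t.+1).
Proof.
move=> fO; have BN : before (chosen alg) t.+1 \subset configs menu.
  exact: subset_trans (before_sub _ _) chosen_configs.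
have [->|[o ot ->]] := feasible_at_arrival t fO.
  by rewrite set0U welfare_mono // beforeS subsetUr.
(* Greedy abstains only when nothing is available, which [o] rules out. *)
have := halg t; case et: (alg t) => [e|]; last by move=> N0; rewrite N0 inE in ot.
case=> eN /(_ o ot); rewrite !sum_marginal chosen_beforeE lerBlDr subrK.
suff -> : before (chosen alg) t.+1 = [set e] :|: before (chosen alg) t by [].
rewrite beforeS; congr (_ :|: _); apply/setP => x; rewrite in_set1 in_set.
apply/andP/eqP => [[/chosenP xs /eqP/val_inj xt]|->].
  by move: xs; rewrite xt et => -[].
by have e2 := configs_at_arrival eN; split; [apply/chosenP; rewrite e2 | rewrite e2].
Qed.

(** Induction on [n]: the configurations of [O] are stripped off from the first arrival onwards,
    each loss being at most the greedy gain at that arrival, and these gains telescope. *)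
Lemma welfare_exchange O n : feasible menu O -> (n <= T)%N ->
  welfare f (chosen alg :|: O) <=
  welfare f (chosen alg :|: from O n) + welfare f (before (chosen alg) n).
Proof.
move=> fO; have /andP[ON _] := fO.
elim: n => [_|n IHn nT].
  rewrite from0 lerDl before0; apply: sumr_ge0 => i _.
  by rewrite (osow_set0 hf).
have exch : welfare f (chosen alg :|: from O n) -
    welfare f (chosen alg :|: from O n.+1) <=
    welfare f (at_arrival O n :|: before (chosen alg) n) -
    welfare f (before (chosen alg) n).
  (* The same order serves every resource, so the bounds add up to the sum that Greedy maximizes. *)
  rewrite -sum_marginal -sumrB; apply: ler_sum => i _.
  apply: exchange_step => //; last exact: chosen_configs.
    exact: (osow_monotone hf).
  apply: (osow_submodular_order hf); first exact: order_first_total.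
  exact: order_first_consistent.
have := IHn (ltnW nT); have := greedy_step (Ordinal nT) fO.
by move: exch => /=; lra.
Qed.

End Greedy.

Theorem theorem1 (R : realFieldType) (I : finType) (T : nat)
    (menu : 'I_T -> {set {set I}}) (f : I -> {set config I T} -> R)
    (hf : osow menu f)
    (alg : 'I_T -> option (config I T)) (halg : greedy_run menu f alg) :
  welfare f (chosen alg) >= 2^-1 * OPT menu f.
Proof.
rewrite /OPT; case: arg_maxP => [|O fO _]; first exact: feasible_set0.
(* At [n = T] nothing of [O] remains and both terms on the right are the welfare of ALG. *)
have := welfare_exchange hf halg fO (leqnn T).
rewrite from_all setU0 before_all.
have /andP[ON _] := fO.
have : welfare f O <= welfare f (chosen alg :|: O).
  by apply: welfare_mono hf _ _ _ _; rewrite ?subsetUr // subUset (chosen_configs halg).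
lra.
Qed.
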